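(* Let $\gamma \in \{1, i\}$, where $i$ is the imaginary unit. There exists a unique continuous function $e : \mathbb{R} \to \mathbb{C}$ such that $$e(2x) = e(x)^2 \quad \text{for all } x \in \mathbb{R}, \qquad e(0) = 1, \qquad e \text{ is differentiable at } 0 \text{ with } e'(0) = \gamma .$$ Specifically, $e(x) = 1 + \gamma x + x^2 q(x)$ for all $x \in \mathbb{R}$, where $q : \mathbb{R} \to \mathbb{C}$ is the unique continuous solution of the functional equation $$q(x) = \frac{\gamma^2}{4} + \left( \frac{1}{2} + \gamma \frac{x}{4} \right) q\left( \frac{x}{2} \right) + \frac{x^2}{16}\, q\left( \frac{x}{2} \right)^2 \qquad (x \in \mathbb{R}).$$
   Context: The derivative $e'(0)$ is the limit of the difference quotient $(e(x)-e(0))/x$ as $x \to 0$, $x \in \mathbb{R}\setminus\{0\}$. No differentiability of $e$ away from $0$ is assumed. *)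

(* Defs.v *)
(* Stdlib reals + Coquelicot. *)
From Stdlib Require Import Reals.
From Coquelicot Require Import Coquelicot.
Open Scope C_scope.

(* [locally' 0] is the punctured neighbourhood filter of 0 in R. *)
Definition has_deriv_at_0 (e : R -> C) (l : C) : Prop :=
  filterlim (fun x : R => (e x - e 0%R) / x) (locally' 0%R) (locally l).

Definition doubling_solution (gamma : C) (e : R -> C) : Prop :=
  (forall x : R, continuous e x) /\
  (forall x : R, e (2 * x)%R = e x ^ 2) /\
  e 0%R = 1 /\
  has_deriv_at_0 e gamma.

Definition remainder_solution (gamma : C) (q : R -> C) : Prop :=
  (forall x : R, continuous q x) /\
  forall x : R,
    q x = gamma ^ 2 / 4 + (1 / 2 + gamma * (x / 4)) * q (x / 2)%R
          + x ^ 2 / 16 * q (x / 2)%R ^ 2.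

(* Main.v *)
Require Import Defs.
From Stdlib Require Import Reals Lra Lia FunctionalExtensionality.
From Coquelicot Require Import Coquelicot.
Open Scope C_scope.

(** Uniqueness of [e]: iterating the doubling rule gives
    [e x = e (x / N) ^ N] with [N = 2 ^ n].  Two solutions agree to first order
    at 0, so at [x / N] they differ by [o(1 / N)] and both have modulus at most
    [exp (M |x| / N)] with [M = |gamma| + 1]; since
    [|a ^ N - b ^ N| <= N K ^ N |a - b|] when [|a|, |b| <= K], the difference at
    [x] is at most [exp (M |x|) o(1)].
    If [q] solves the remainder equation then [1 + gamma x + x ^ 2 q x] solves
    the doubling problem, so uniqueness of [q] and the formula for [e] follow.
    Existence of [q]: solve for [q] in terms of [exp (gamma x)]; continuity at 0
    is second order Taylor expansion. *)

(** * Limits and continuity in C *)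

Lemma filterlim_Cmod {T : Type} (F : (T -> Prop) -> Prop) (FF : Filter F)
    (f : T -> C) (l : C) :
  filterlim f F (locally l) ->
  forall eps : posreal, F (fun x => (Cmod (f x - l) < eps)%R).
Proof.
intros Hf eps.
apply (Hf (fun z => (Cmod (z - l) < eps)%R)).
apply locally_C.
exists eps; intros z Hz; exact Hz.
Qed.

(** C carries two uniform structures, the product one and the one induced by [Cmod]. The library's
    product rule concerns the second; [locally_C] identifies their neighbourhoods. *)
Lemma continuous_Cmult {U : UniformSpace} (f g : U -> C) (x : U) :
  @continuous U C_UniformSpace f x -> @continuous U C_UniformSpace g x ->
  @continuous U C_UniformSpace (fun y => f y * g y) x.
Proof.
assert (E : forall h : U -> C,
  @continuous U C_UniformSpace h x <->
  @continuous U (AbsRing_UniformSpace C_AbsRing) h x).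
{ intros h; split; intros Hh P HP; apply Hh; apply locally_C; exact HP. }
intros Hf Hg; apply E.
apply (continuous_mult (K := C_AbsRing) f g x); apply E; assumption.
Qed.

Lemma continuous_Cplus {U : UniformSpace} (f g : U -> C) (x : U) :
  @continuous U C_UniformSpace f x -> @continuous U C_UniformSpace g x ->
  @continuous U C_UniformSpace (fun y => f y + g y) x.
Proof. exact (continuous_plus (V := C_NormedModule) f g x). Qed.

Lemma continuous_pair {U V W : UniformSpace} (f : U -> V) (g : U -> W) (x : U) :
  continuous f x -> continuous g x -> continuous (fun y => (f y, g y)) x.
Proof.
intros Hf Hg.
apply (continuous_comp_2 f g (fun u v => (u, v)) x Hf Hg).
apply continuous_ext with (f := fun z : V * W => z).
- intros [u v]; reflexivity.
- apply continuous_id.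
Qed.

Lemma continuous_RtoC (x : R) : @continuous R_UniformSpace C_UniformSpace RtoC x.
Proof.
apply (continuous_pair (fun y : R => y) (fun _ : R => 0%R)).
- apply continuous_id.
- apply continuous_const.
Qed.

Lemma RtoC_neq_0 (x : R) : x <> 0%R -> RtoC x <> 0.
Proof. intros Hx H; apply Hx, RtoC_inj, H. Qed.

Lemma RtoC_half (x : R) : RtoC (x / 2) = x / 2.
Proof. apply RtoC_div; lra. Qed.

(** * Iterated doubling and uniqueness *)

Lemma exp_pow_INR (t : R) (n : nat) : (exp t ^ n = exp (INR n * t))%R.
Proof.
induction n as [|n IH].
- simpl. rewrite Rmult_0_l, exp_0; reflexivity.
- rewrite S_INR, Rmult_plus_distr_r, Rmult_1_l, exp_plus, <- IH. simpl; ring.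
Qed.

(** Induction on a^(n+1) - b^(n+1) = a (a^n - b^n) + b^n (a - b). Since [1 <= K], the exponent [n]
    can stand in for n - 1, which avoids a predecessor. *)
Lemma Cmod_pow_minus (a b : C) (K : R) (n : nat) :
  (1 <= K)%R -> (Cmod a <= K)%R -> (Cmod b <= K)%R ->
  (Cmod (a ^ n - b ^ n) <= INR n * K ^ n * Cmod (a - b))%R.
Proof.
intros HK Ha Hb.
induction n as [|n IH].
- simpl. replace (1 - 1) with (RtoC 0) by ring. rewrite Cmod_0; lra.
- replace (a ^ S n - b ^ S n) with (a * (a ^ n - b ^ n) + b ^ n * (a - b))
    by (simpl; ring).
  eapply Rle_trans; [apply Cmod_triangle|].
  rewrite !Cmod_mult, Cmod_pow, S_INR.
  assert (H1 : (Cmod b ^ n <= K ^ n)%R).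
  { apply pow_incr; split; [apply Cmod_ge_0 | exact Hb]. }
  assert (H2 : (K ^ n <= K ^ S n)%R) by (apply Rle_pow; [exact HK | lia]).
  assert (H3 : (Cmod a * Cmod (a ^ n - b ^ n)
                <= K * (INR n * K ^ n * Cmod (a - b)))%R).
  { apply Rmult_le_compat; try apply Cmod_ge_0; assumption. }
  assert (H4 : (Cmod b ^ n * Cmod (a - b) <= K ^ S n * Cmod (a - b))%R).
  { apply Rmult_le_compat_r; [apply Cmod_ge_0 | lra]. }
  simpl in *; lra.
Qed.

Lemma doubling_iterate (e : R -> C) (x : R) (n : nat) :
  (forall y : R, e (2 * y)%R = e y ^ 2) -> e x = e (x / 2 ^ n)%R ^ (2 ^ n).
Proof.
intros He; induction n as [|n IH].
- rewrite pow_O, Rdiv_1_r. symmetry; apply Cpow_1_r.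
- replace (2 ^ S n)%nat with (2 * 2 ^ n)%nat by reflexivity.
  rewrite Cpow_mult_r, <- He, IH at 1.
  do 2 f_equal. simpl. field. apply pow_nonzero; lra.
Qed.

(** Clearing the denominator of the difference quotient gives the bound for [y] nonzero; the point
    0, absent from the punctured neighbourhood, is covered by [e 0 = 1]. *)
Lemma first_order_at_0 (e : R -> C) (l : C) (eps : R) :
  e 0%R = 1 -> has_deriv_at_0 e l -> (0 < eps)%R ->
  exists d : posreal, forall y : R, (Rabs y < d)%R ->
    (Cmod (e y - (1 + l * y)) <= eps * Rabs y)%R.
Proof.
intros He0 Hd Heps.
destruct (filterlim_Cmod _ _ _ _ Hd (mkposreal eps Heps)) as [d Hy].
exists d; intros y Hyd.
destruct (Req_dec y 0) as [->|Hy0].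
- rewrite He0, Rabs_R0.
  replace (1 - (1 + l * 0)) with (RtoC 0) by ring. rewrite Cmod_0; lra.
- assert (Hb : ball (M := R_UniformSpace) 0%R d y).
  { change (Rabs (y - 0) < d)%R. rewrite Rminus_0_r; exact Hyd. }
  specialize (Hy y Hb Hy0); simpl in Hy; rewrite He0 in Hy.
  replace (e y - (1 + l * y)) with (((e y - 1) / y - l) * y)
    by (field; apply RtoC_neq_0, Hy0).
  rewrite Cmod_mult, Cmod_R.
  apply Rmult_le_compat_r; [apply Rabs_pos | lra].
Qed.

Lemma doubling_solution_unique (gamma : C) (e1 e2 : R -> C) :
  doubling_solution gamma e1 -> doubling_solution gamma e2 ->
  forall x : R, e1 x = e2 x.
Proof.
intros (_ & D1 & Z1 & L1) (_ & D2 & Z2 & L2) x.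
(* For eps <= 1, |1 + gamma y| + eps |y| <= 1 + M |y| <= exp (M |y|). *)
set (M := (Cmod gamma + 1)%R).
assert (HM : (0 <= M)%R) by (unfold M; pose proof (Cmod_ge_0 gamma); lra).
(* With y = x / 2^n, the power estimate gives 2^n exp (M |x|) times 2 eps |y|, which is eps A
   because 2^n |y| = |x|. *)
set (A := (2 * Rabs x * exp (M * Rabs x))%R).
assert (bound : forall eps : R, (0 < eps <= 1)%R ->
  (Cmod (e1 x - e2 x) <= eps * A)%R).
{ intros eps [Heps Heps1].
  destruct (first_order_at_0 e1 gamma eps Z1 L1 Heps) as [d1 H1].
  destruct (first_order_at_0 e2 gamma eps Z2 L2 Heps) as [d2 H2].
  pose (d := Rmin d1 d2).
  assert (Hd : (0 < d)%R) by (apply Rmin_pos; apply cond_pos).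
  (* The added 1 turns the weak inequality supplied here into 2^n > |x| / d, that is |y| < d. *)
  destruct (Pow_x_infinity 2 ltac:(rewrite Rabs_pos_eq; lra) (Rabs x / d + 1)%R)
    as [n Hn].
  specialize (Hn n (Nat.le_refl n)).
  assert (H2n : (0 < 2 ^ n)%R) by (apply pow_lt; lra).
  rewrite Rabs_pos_eq in Hn by lra.
  set (y := (x / 2 ^ n)%R).
  assert (Hxy : (2 ^ n * Rabs y = Rabs x)%R).
  { unfold y, Rdiv. rewrite Rabs_mult, Rabs_inv, (Rabs_pos_eq (2 ^ n)) by lra.
    field; lra. }
  assert (Hyd : (Rabs y < d)%R).
  { apply Rmult_lt_reg_l with (2 ^ n)%R; [exact H2n|]. rewrite Hxy.
    replace (Rabs x) with (Rabs x / d * d)%R by (field; lra).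
    apply Rmult_lt_compat_r; lra. }
  assert (Hy1 := H1 y (Rlt_le_trans _ _ _ Hyd (Rmin_l _ _))).
  assert (Hy2 := H2 y (Rlt_le_trans _ _ _ Hyd (Rmin_r _ _))).
  assert (size : forall z : C, (Cmod (z - (1 + gamma * y)) <= eps * Rabs y)%R ->
    (Cmod z <= exp (M * Rabs y))%R).
  { intros z Hz.
    replace z with ((z - (1 + gamma * y)) + (1 + gamma * y)) by ring.
    eapply Rle_trans; [apply Cmod_triangle|].
    pose proof (Cmod_triangle 1 (gamma * y)) as Ht.
    rewrite Cmod_1, Cmod_mult, Cmod_R in Ht.
    pose proof (exp_ineq1_le (M * Rabs y)) as Hexp.
    pose proof (Rabs_pos y). unfold M in *. nra. }
  rewrite (doubling_iterate e1 x n D1), (doubling_iterate e2 x n D2).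
  fold y.
  assert (HK : (1 <= exp (M * Rabs y))%R).
  { pose proof (exp_ineq1_le (M * Rabs y)). pose proof (Rabs_pos y). nra. }
  eapply Rle_trans.
  { exact (Cmod_pow_minus _ _ _ (2 ^ n) HK (size _ Hy1) (size _ Hy2)). }
  assert (Hpow : (exp (M * Rabs y) ^ (2 ^ n) = exp (M * Rabs x))%R).
  { rewrite exp_pow_INR, pow_INR. f_equal.
    replace (INR 2) with 2%R by reflexivity. rewrite <- Hxy; ring. }
  rewrite Hpow, pow_INR. replace (INR 2) with 2%R by reflexivity.
  assert (Hdiff : (Cmod (e1 y - e2 y) <= 2 * eps * Rabs y)%R).
  { replace (e1 y - e2 y) with
      ((e1 y - (1 + gamma * y)) + - (e2 y - (1 + gamma * y))) by ring.
    eapply Rle_trans; [apply Cmod_triangle|]. rewrite Cmod_opp. lra. }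
  unfold A. rewrite <- Hxy at 2.
  pose proof (exp_pos (M * Rabs x)).
  replace (eps * (2 * (2 ^ n * Rabs y) * exp (M * Rabs x)))%R
    with (2 ^ n * exp (M * Rabs x) * (2 * eps * Rabs y))%R by ring.
  apply Rmult_le_compat_l; [nra | exact Hdiff]. }
apply Ceq_minus, Cmod_eq_0.
apply Rle_antisym; [|apply Cmod_ge_0].
assert (HA : (0 <= A)%R).
{ unfold A. pose proof (Rabs_pos x). pose proof (exp_pos (M * Rabs x)). nra. }
apply Rle_plus_epsilon; intros eta Heta.
(* The cap at 1 is what [bound] requires; [A + 1] keeps the denominator positive when [A] is 0. *)
pose (eps := Rmin 1 (eta / (A + 1))).
assert (Hq : (0 < eta / (A + 1))%R) by (apply Rdiv_lt_0_compat; lra).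
assert (Heps : (0 < eps <= 1)%R).
{ split; [apply Rmin_pos; lra | apply Rmin_l]. }
eapply Rle_trans; [exact (bound eps Heps)|].
assert (Hle : (eps <= eta / (A + 1))%R) by apply Rmin_r.
assert (E : (eta = eta / (A + 1) * (A + 1))%R) by (field; lra).
nra.
Qed.

(** * From the remainder equation to the doubling equation *)

Lemma doubling_of_remainder (gamma : C) (q : R -> C) :
  remainder_solution gamma q ->
  doubling_solution gamma (fun x : R => 1 + gamma * x + x ^ 2 * q x).
Proof.
intros [Hc Hq].
assert (Hx : forall x, @continuous R_UniformSpace C_UniformSpace
                         (fun y : R => gamma * y) x).
{ intros x; apply continuous_Cmult; [apply continuous_const | apply continuous_RtoC]. }
split; [|split; [|split]].
- intros x. apply continuous_Cplus.
  + apply continuous_Cplus; [apply continuous_const | apply Hx].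
  + apply continuous_Cmult; [|apply Hc].
    apply continuous_Cmult; [apply continuous_RtoC|].
    apply continuous_Cmult; [apply continuous_RtoC | apply continuous_const].
(* Multiplied by (2x)^2, the remainder equation at 2x is the expansion of (1 + gamma x + x^2 q(x))^2
   without the terms 1 + 2 gamma x. *)
- intros x. rewrite (Hq (2 * x)%R).
  replace (2 * x / 2)%R with x by field.
  rewrite RtoC_mult. field.
- ring.
- unfold has_deriv_at_0.
  apply filterlim_within_ext with (f := fun x : R => gamma + x * q x).
  { intros x Hx0. field. apply RtoC_neq_0, Hx0. }
  apply (filterlim_filter_le_1 (F := locally 0%R)).
  { apply filter_le_within. }
  assert (H : @continuous R_UniformSpace C_UniformSpace
                (fun x : R => gamma + x * q x) 0%R).
  { apply continuous_Cplus; [apply continuous_const|].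
    apply continuous_Cmult; [apply continuous_RtoC | apply Hc]. }
  unfold continuous in H.
  replace (gamma + 0 * q 0%R) with gamma in H by ring. exact H.
Qed.

Lemma remainder_at_0 (gamma : C) (q : R -> C) :
  remainder_solution gamma q -> q 0%R = gamma ^ 2 / 2.
Proof.
intros [_ Hq]. specialize (Hq 0%R).
replace (0 / 2)%R with 0%R in Hq by field.
assert (H2 : q 0%R = 2 * (q 0%R - 1 / 2 * q 0%R)) by field.
rewrite H2, Hq at 1. field.
Qed.

(** Away from 0, [q] is recovered from the associated doubling solution by dividing by x^2; at 0 its
    value is forced by the equation itself. *)
Lemma remainder_solution_unique (gamma : C) (q1 q2 : R -> C) :
  remainder_solution gamma q1 -> remainder_solution gamma q2 ->
  forall x : R, q1 x = q2 x.
Proof.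
intros H1 H2 x.
destruct (Req_dec x 0) as [->|Hx].
- rewrite (remainder_at_0 _ _ H1), (remainder_at_0 _ _ H2); reflexivity.
- assert (E := doubling_solution_unique gamma _ _
    (doubling_of_remainder _ _ H1) (doubling_of_remainder _ _ H2) x).
  simpl in E.
  assert (Hx' := RtoC_neq_0 x Hx).
  replace (q1 x) with ((1 + gamma * x + x ^ 2 * q1 x - (1 + gamma * x)) / x ^ 2)
    by (field; exact Hx').
  simpl; rewrite E. field; exact Hx'.
Qed.

(** * Second order Taylor quotients and existence *)

Definition taylor2_quotient (f : R -> R) (a b c x : R) : R :=
  if Req_EM_T x 0 then c / 2 else (f x - a - b * x) / x ^ 2.

(** At 0 this is Taylor's formula with second derivative only at 0: the mean value theorem moves the
    estimate from [f] to [f'], whose derivative at 0 is [c]. *)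
Lemma continuous_taylor2_quotient (f f' : R -> R) (a b c : R) :
  f 0%R = a -> f' 0%R = b ->
  (forall x, is_derive f x (f' x)) -> is_derive f' 0 c ->
  forall x, continuous (taylor2_quotient f a b c) x.
Proof.
intros <- <- Hf Hf' x.
destruct (Req_dec x 0) as [->|Hx].
- apply filterlim_locally; intros eps.
  assert (He : (0 < eps)%R) by apply cond_pos.
  apply is_derive_Reals in Hf'.
  destruct (Hf' eps He) as [d Hd].
  exists d; intros y Hy.
  change (Rabs (y - 0) < d)%R in Hy. rewrite Rminus_0_r in Hy.
  change (Rabs (taylor2_quotient f (f 0) (f' 0) c y
                - taylor2_quotient f (f 0) (f' 0) c 0) < eps)%R.
  unfold taylor2_quotient at 2.
  destruct (Req_EM_T 0 0) as [_|N]; [|lra].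
  unfold taylor2_quotient.
  destruct (Req_EM_T y 0) as [->|Hy0].
  { rewrite Rminus_diag, Rabs_R0; exact He. }
  (* The quantity to bound is h(y) / y^2, and h(0) = 0, so it equals h'(t) / y for some t between 0
     and y. *)
  pose (h t := (f t - f 0 - f' 0 * t - c / 2 * t ^ 2)%R).
  assert (Hh : forall t, is_derive h t (f' t - f' 0 - c * t)%R).
  { intros t. unfold h. auto_derive.
    - exists (f' t); apply Hf.
    - replace (Derive _ t) with (f' t)
        by (symmetry; apply is_derive_unique, Hf). field. }
  destruct (MVT_gen h 0 y (fun t => f' t - f' 0 - c * t)%R) as [t [Ht Et]].
  { intros t _; apply Hh. }
  { intros t _. apply continuity_pt_filterlim.
    apply (ex_derive_continuous h). eexists; apply Hh. }
  assert (Hty : (Rabs t <= Rabs y)%R).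
  { revert Ht. unfold Rmin, Rmax. destruct (Rle_dec 0 y); intros Ht;
    unfold Rabs; destruct (Rcase_abs t), (Rcase_abs y); lra. }
  assert (Hy1 : (0 < Rabs y)%R) by (apply Rabs_pos_lt, Hy0).
  replace ((f y - f 0 - f' 0 * y) / y ^ 2 - c / 2)%R
    with ((f' t - f' 0 - c * t) / y)%R.
  2: { apply Rmult_eq_reg_r with (y ^ 2)%R; [|apply pow_nonzero, Hy0].
       transitivity ((f' t - f' 0 - c * t) * (y - 0))%R; [field; exact Hy0|].
       rewrite <- Et. unfold h. field; exact Hy0. }
  unfold Rdiv; rewrite Rabs_mult, Rabs_inv.
  apply Rmult_lt_reg_r with (Rabs y); [exact Hy1|].
  rewrite Rmult_assoc, Rinv_l, Rmult_1_r by lra.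
  (* [MVT_gen] places [t] in the closed interval, so [t = 0] is possible, whereas [Hd] needs a
     nonzero increment. *)
  destruct (Req_dec t 0) as [->|Ht0].
  { replace (f' 0 - f' 0 - c * 0)%R with 0%R by ring. rewrite Rabs_R0; nra. }
  assert (Hyt := Hd t Ht0 (Rle_lt_trans _ _ _ Hty Hy)).
  rewrite Rplus_0_l in Hyt.
  replace (f' t - f' 0 - c * t)%R
    with (((f' t - f' 0) / t - c) * t)%R by (field; exact Ht0).
  rewrite Rabs_mult.
  pose proof (Rabs_pos_lt t Ht0). nra.
- apply continuous_ext_loc with (g := fun y => ((f y - f 0 - f' 0 * y) / y ^ 2)%R).
  (* The ball of radius |x| about x misses 0. *)
  + exists (mkposreal _ (Rabs_pos_lt x Hx)). intros y Hy.
    change (Rabs (y - x) < Rabs x)%R in Hy.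
    unfold taylor2_quotient. destruct (Req_EM_T y 0) as [->|_]; [|reflexivity].
    rewrite Rminus_0_l, Rabs_Ropp in Hy; lra.
  + apply (ex_derive_continuous (fun y => (f y - f 0 - f' 0 * y) / y ^ 2)%R).
    auto_derive. repeat split; trivial.
    * exists (f' x); apply Hf.
    * apply pow_nonzero with (n := 2%nat) in Hx. simpl in Hx. exact Hx.
Qed.

(** The function exp (gamma x), split into real and imaginary parts so that real calculus
    applies. *)
Definition exp_line (gamma : C) (x : R) : C :=
  ((exp (Re gamma * x) * cos (Im gamma * x))%R,
   (exp (Re gamma * x) * sin (Im gamma * x))%R).

Lemma exp_line_double (gamma : C) (x : R) :
  exp_line gamma (2 * x)%R = exp_line gamma x ^ 2.
Proof.
unfold exp_line.
replace (Re gamma * (2 * x))%R with (Re gamma * x + Re gamma * x)%R by ring.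
replace (Im gamma * (2 * x))%R with (2 * (Im gamma * x))%R by ring.
rewrite exp_plus, cos_2a, sin_2a.
simpl. unfold Cmult, RtoC; simpl. f_equal; ring.
Qed.

(** Componentwise (exp (gamma x) - 1 - gamma x) / x^2; the last coefficients are the real and
    imaginary parts of gamma^2, the second derivative at 0. *)
Definition exp_remainder (gamma : C) (x : R) : C :=
  let a := Re gamma in let b := Im gamma in
  (taylor2_quotient (fun t => exp (a * t) * cos (b * t))%R 1 a (a ^ 2 - b ^ 2) x,
   taylor2_quotient (fun t => exp (a * t) * sin (b * t))%R 0 b (2 * a * b) x).

Lemma exp_remainder_neq_0 (gamma : C) (x : R) :
  x <> 0%R -> exp_remainder gamma x = (exp_line gamma x - 1 - gamma * x) / x ^ 2.
Proof.
intros Hx.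
(* A real scalar in place of complex division lets the two components be compared separately. *)
transitivity (RtoC (/ x ^ 2) * (exp_line gamma x - 1 - gamma * x)).
- unfold exp_remainder, taylor2_quotient.
  destruct (Req_EM_T x 0) as [N|_]; [contradiction|].
  destruct gamma as [a b]. unfold exp_line, Cmult, Cminus, Cplus, Copp, RtoC; simpl.
  f_equal; field; exact Hx.
- rewrite RtoC_inv, RtoC_pow by (apply pow_nonzero, Hx).
  field. apply RtoC_neq_0, Hx.
Qed.

Lemma exp_remainder_0 (gamma : C) : exp_remainder gamma 0%R = gamma ^ 2 / 2.
Proof.
transitivity (RtoC (/ 2) * gamma ^ 2).
- unfold exp_remainder, taylor2_quotient.
  destruct (Req_EM_T 0 0) as [_|N]; [|lra].
  destruct gamma as [a b]; unfold RtoC; simpl; unfold Cmult; simpl. f_equal; field.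
- rewrite RtoC_inv by lra. field.
Qed.

Lemma exp_remainder_solution (gamma : C) :
  remainder_solution gamma (exp_remainder gamma).
Proof.
split.
- intros x. unfold exp_remainder.
  set (a := Re gamma). set (b := Im gamma).
  apply continuous_pair.
  + apply continuous_taylor2_quotient with (f' := fun t =>
      (a * (exp (a * t) * cos (b * t)) - b * (exp (a * t) * sin (b * t)))%R).
    * rewrite !Rmult_0_r, exp_0, cos_0. ring.
    * rewrite !Rmult_0_r, exp_0, cos_0, sin_0. ring.
    * intros t; auto_derive; [trivial|ring].
    * auto_derive; [trivial|]. rewrite !Rmult_0_r, exp_0, cos_0, sin_0. ring.
  + apply continuous_taylor2_quotient with (f' := fun t =>
      (a * (exp (a * t) * sin (b * t)) + b * (exp (a * t) * cos (b * t)))%R).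
    * rewrite !Rmult_0_r, exp_0, sin_0. ring.
    * rewrite !Rmult_0_r, exp_0, cos_0, sin_0. ring.
    * intros t; auto_derive; [trivial|ring].
    * auto_derive; [trivial|]. rewrite !Rmult_0_r, exp_0, cos_0, sin_0. ring.
- intros x. destruct (Req_dec x 0) as [->|Hx].
  + replace (0 / 2)%R with 0%R by field. rewrite exp_remainder_0.
    field.
  + assert (Hx2 : (x / 2)%R <> 0%R) by lra.
    rewrite !exp_remainder_neq_0 by assumption.
    (* Now only the value at x / 2 occurs, and the equation is a rational identity in it. *)
    replace (exp_line gamma x) with (exp_line gamma (x / 2)%R ^ 2)
      by (rewrite <- exp_line_double; f_equal; field).
    rewrite RtoC_half. field.
    apply RtoC_neq_0, Hx.
Qed.

Theorem theorem2 :
  forall gamma : C, gamma = 1 \/ gamma = Ci ->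
    (exists! e : R -> C, doubling_solution gamma e) /\
    (exists! q : R -> C, remainder_solution gamma q) /\
    (forall e q : R -> C,
       doubling_solution gamma e -> remainder_solution gamma q ->
       forall x : R, e x = 1 + gamma * x + x ^ 2 * q x).
Proof.
intros gamma _.
assert (Hq := exp_remainder_solution gamma).
split; [|split].
- exists (fun x : R => 1 + gamma * x + x ^ 2 * exp_remainder gamma x).
  assert (He := doubling_of_remainder gamma _ Hq).
  split; [exact He|].
  intros e' He'. apply functional_extensionality.
  exact (doubling_solution_unique gamma _ _ He He').
- exists (exp_remainder gamma); split; [exact Hq|].
  intros q' Hq'. apply functional_extensionality.
  exact (remainder_solution_unique gamma _ _ Hq Hq').
- intros e q He Hq'.
  exact (doubling_solution_unique gamma _ _ He (doubling_of_remainder _ _ Hq')).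
Qed.
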